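(* Let $V$ be the orientation of the $3$-dimensional cube with vertices $s_1,s_2,s_3,b_1,b_2,b_3,v_1,v_2$ and the twelve arcs $\overrightarrow{b_3s_1},\ \overrightarrow{s_1s_3},\ \overrightarrow{s_3v_1},\ \overrightarrow{b_3v_1},\ \overrightarrow{b_1v_2},\ \overrightarrow{b_2v_2},\ \overrightarrow{b_2s_2},\ \overrightarrow{b_1s_2},\ \overrightarrow{b_1s_1},\ \overrightarrow{b_3v_2},\ \overrightarrow{s_2s_3},\ \overrightarrow{b_2v_1}$ (so $b_1,b_2,b_3$ have out-degree $3$ and $v_1,v_2$ have in-degree $3$). Then $V$ is not $(2,3)$-cordial.
   Context: A labeling $f$ of the vertex set $\{0,1\}$-valued is friendly if $-1\le |f^{-1}(0)|-|f^{-1}(1)|\le 1$. For a digraph $D=(W,A)$ and $f:W\to\{0,1\}$, the induced arc labeling is $g:A\to\{1,-1,0\}$, $g(\overrightarrow{uv})=f(v)-f(u)$. $D$ is $(2,3)$-cordial if there exists a friendly $f$ such that for all $i,j\in\{1,-1,0\}$, $-1\le |g^{-1}(i)|-|g^{-1}(j)|\le 1$. (The underlying undirected graph of $V$ is the 3-cube: two 4-cycles $s_1b_3v_1s_3$ and $b_1v_2b_2s_2$ joined by the edges $s_1b_1$, $b_3v_2$, $s_3s_2$, $v_1b_2$.) *)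

(* Defs.v *)
From HB Require Import structures.
From mathcomp Require Import all_boot all_order all_algebra.
Import Order.TTheory GRing.Theory Num.Theory.

Set Implicit Arguments.
Unset Strict Implicit.
Unset Printing Implicit Defensive.

Local Open Scope ring_scope.

(* A digraph (W, A) is a finite vertex type W with its arc set
   A : {set W * W}, the pair (u, v) being the arc from u to v.  A labeling
   with values in {0, 1} is a function W -> bool, read through the coercion
   false |-> 0, true |-> 1. *)

Definition friendly (W : finType) (f : W -> bool) : Prop :=
  -1 <= #|[set w | f w == false]|%:Z - #|[set w | f w == true]|%:Z <= 1.

Definition arc_label (W : finType) (f : W -> bool) (a : W * W) : int :=
  (f a.2 : nat)%:Z - (f a.1 : nat)%:Z.

Definition arc_count (W : finType) (A : {set W * W}) (f : W -> bool)
    (i : int) : nat :=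
  #|[set a in A | arc_label f a == i]|.

Definition cordial23 (W : finType) (A : {set W * W}) : Prop :=
  exists f : W -> bool,
    friendly f /\
    forall i j : int, i \in [:: 1; -1; 0] -> j \in [:: 1; -1; 0] ->
      -1 <= (arc_count A f i)%:Z - (arc_count A f j)%:Z <= 1.

Inductive cube_vertex : Type := s1 | s2 | s3 | b1 | b2 | b3 | v1 | v2.

Definition cube_vertices : seq cube_vertex :=
  [:: s1; s2; s3; b1; b2; b3; v1; v2].

Definition cube_vertex_code (x : cube_vertex) : nat :=
  match x with
  | s1 => 0 | s2 => 1 | s3 => 2 | b1 => 3 | b2 => 4 | b3 => 5 | v1 => 6 | v2 => 7
  end.

Lemma cube_vertex_codeK : pcancel cube_vertex_code (onth cube_vertices).
Proof. by case. Qed.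

HB.instance Definition _ :=
  Countable.copy cube_vertex (pcan_type cube_vertex_codeK).

Lemma cube_vertices_enumP : Finite.axiom cube_vertices.
Proof. by case. Qed.

HB.instance Definition _ := isFinite.Build cube_vertex cube_vertices_enumP.

Definition V_arcs : {set cube_vertex * cube_vertex} :=
  [set (b3, s1); (s1, s3); (s3, v1); (b3, v1);
       (b1, v2); (b2, v2); (b2, s2); (b1, s2);
       (b1, s1); (b3, v2); (s2, s3); (b2, v1)].

Definition cube_coord (x : cube_vertex) : bool * bool * bool :=
  match x with
  | s1 => (false, false, false) | b3 => (true, false, false)
  | v1 => (true, true, false)   | s3 => (false, true, false)
  | b1 => (false, false, true)  | v2 => (true, false, true)
  | b2 => (true, true, true)    | s2 => (false, true, true)
  end.

Lemma cube_coord_bij : bijective cube_coord.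
Proof.
exists (fun c => match c with
  | (false, false, false) => s1 | (true, false, false) => b3
  | (true, true, false) => v1   | (false, true, false) => s3
  | (false, false, true) => b1  | (true, false, true) => v2
  | (true, true, true) => b2    | (false, true, true) => s2 end).
  by case.
by case=> [[[] []] []].
Qed.

(* V_arcs contains exactly one orientation of each edge of the 3-cube, and no
   other arc: edges join the vertices of {0,1}^3 at Hamming distance 1. *)
Lemma V_arcs_orients_cube (x y : cube_vertex) :
  let c := cube_coord x in let d := cube_coord y in
  ~~ (((x, y) \in V_arcs) && ((y, x) \in V_arcs)) /\
  ((x, y) \in V_arcs) || ((y, x) \in V_arcs) =
  (((c.1.1 != d.1.1) + (c.1.2 != d.1.2) + (c.2 != d.2))%N == 1%N).
Proof. by rewrite !inE; case: x; case: y. Qed.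

(* Main.v *)
Require Import Defs.
From mathcomp Require Import all_boot all_order all_algebra.

(* The twelve arcs must split into exactly four of each label, and four vertices
   are labeled 1.  Summing f(v) - f(u) over the arcs gives
   3 (#v - #b) + #s = 0, where #v, #b, #s count the vertices labeled 1 among the
   v_i, b_i, s_i; as #s + #b + #v = 4, either #s = 0 and #b = #v = 2, or #s = 3,
   #b = 1 and #v = 0.  The four vertices labeled 1 must span exactly two edges
   (eight arcs have a nonzero label and the cube is 3-regular), whereas in each of
   these six cases they span three or four.  The formal argument needs no such case
   distinction: it evaluates the conditions on all 256 labelings. *)

(** As a sequence, the arcs can be counted by [count], which reduces by computation, unlike the
    cardinal of a finite set. *)
Definition V_arc_seq : seq (cube_vertex * cube_vertex) :=
  [:: (b3, s1); (s1, s3); (s3, v1); (b3, v1);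
      (b1, v2); (b2, v2); (b2, s2); (b1, s2);
      (b1, s1); (b3, v2); (s2, s3); (b2, v1)].

Lemma card_uniq_set (T : finType) (s : seq T) (P : pred T) :
  uniq s -> #|[set x in [set:: s] | P x]| = count P s.
Proof.
move=> s_uniq; rewrite -size_filter -(card_uniqP (filter_uniq P s_uniq)).
by apply: eq_card => x; rewrite !inE mem_filter andbC.
Qed.

Lemma V_arcs_seq : V_arcs = [set:: V_arc_seq].
Proof. by apply/setP=> -[x y]; rewrite !inE /=; case: x; case: y. Qed.

Lemma cube_vertexT : [set: cube_vertex] = [set:: cube_vertices].
Proof. by apply/setP; case; rewrite !inE. Qed.

Lemma card_cube (P : pred cube_vertex) : #|[set w | P w]| = count P cube_vertices.
Proof.
rewrite -card_uniq_set // -cube_vertexT.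
by apply: eq_card => x; rewrite !inE.
Qed.

Theorem theorem2 : ~ cordial23 V_arcs.
Proof.
case=> f [].
rewrite /friendly !card_cube => friendly_f cordial_f.
(* One instance for each unordered pair of distinct labels; the bound is symmetric in the two
   labels. *)
have {cordial_f} :=
  (cordial_f 1%R 0%R isT isT, cordial_f (-1)%R 0%R isT isT,
   cordial_f 1%R (-1)%R isT isT).
rewrite /arc_count V_arcs_seq !card_uniq_set // => -[[]].
move: friendly_f; rewrite /= /arc_label /=.
(* Once all eight values are fixed, the four bounds are closed integer inequalities, at least one of
   which evaluates to [false]. *)
by case: (f s1); case: (f s2); case: (f s3); case: (f b1); case: (f b2);
   case: (f b3); case: (f v1); case: (f v2).
Qed.
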